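(* Let $n\ge1$, let $G=\mathrm{GL}_n(\mathbb{R})$, $K=\mathrm{O}(n)$, let $\mathfrak{p}_0$ be the space of real symmetric $n\times n$ matrices, and let $\kappa:G\to K$ be the projection of $G$ to $K$ through the Iwasawa decomposition $G=NAK$. Then the following three subsets of $K$ are equal: (a) $\kappa(\exp(\mathfrak{p}_0))$, the image of $\exp(\mathfrak{p}_0)$ under $\kappa$; (b) $\{B\in K: B_r>0 \text{ for all } 1\le r\le n\}$; (c) $\{B\in K: B'_r>0 \text{ for all } 1\le r\le n\}$.
   Context: $K=\mathrm{O}(n)$ is the group of orthogonal matrices in $G=\mathrm{GL}_n(\mathbb{R})$; $N$ is the group of upper triangular unipotent matrices in $G$; $A$ is the group of diagonal matrices with positive diagonal entries. Every $g\in G$ can be written uniquely as $g=nak$ with $n\in N$, $a\in A$, $k\in K$ (Iwasawa decomposition), and $\kappa(g):=k$. The set $\exp(\mathfrak{p}_0)$ is the set of positive definite symmetric matrices in $G$. For a real $n\times n$ matrix $B=(B_{i,j})$ and $1\le r\le n$, put $B_r=\det\big((B_{i,j})_{1\le i,j\le r}\big)$ and $B'_r=\det\big((B_{i,j})_{n-r+1\le i,j\le n}\big)$. *)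

(* Defs.v *)
From HB Require Import structures.
From mathcomp Require Import all_boot all_order all_algebra.
From mathcomp Require Import all_classical all_reals all_analysis.

Set Implicit Arguments.
Unset Strict Implicit.
Unset Printing Implicit Defensive.

Import Order.TTheory GRing.Theory Num.Theory.
Import numFieldNormedType.Exports.

Local Open Scope classical_set_scope.
Local Open Scope ring_scope.

Section Groups.
Variables (R : realType) (n : nat).

Definition orthogonal_group : set 'M[R]_n := [set k | k *m k^T = 1%:M].

(* [is_trig_mx] means lower triangular. *)
Definition unipotent_upper : set 'M[R]_n :=
  [set u | is_trig_mx u^T /\ forall i, u i i = 1].

Definition positive_diagonal : set 'M[R]_n :=
  [set a | is_diag_mx a /\ forall i, 0 < a i i].

Definition symmetric_matrices : set 'M[R]_n := [set S | S^T = S].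

Definition mxexp (X : 'M[R]_n) : 'M[R]_n :=
  lim (series (fun k : nat => (k`!%:R : R)^-1 *: X ^+ k) @ \oo).

(* The Iwasawa decomposition g = u a k of an invertible g is unique, so this
   selects its factor k; the default value 1 is only reached when g is
   singular. *)
Definition iwasawa_kappa (g : 'M[R]_n) : 'M[R]_n :=
  xget 1%:M [set k | orthogonal_group k /\
    exists u a, [/\ unipotent_upper u, positive_diagonal a
                  & g = u *m a *m k]].

Definition leading_minor (r : nat) (hr : (r <= n)%N) (B : 'M[R]_n) : R :=
  \det (mxsub (widen_ord hr) (widen_ord hr) B).

(* [trailing_ord hr i] has value [n - r + i]. *)
Definition trailing_ord (r : nat) (hr : (r <= n)%N) (i : 'I_r) : 'I_n :=
  cast_ord (subnK hr) (rshift (n - r) i).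

Definition trailing_minor (r : nat) (hr : (r <= n)%N) (B : 'M[R]_n) : R :=
  \det (mxsub (trailing_ord hr) (trailing_ord hr) B).

End Groups.

Arguments orthogonal_group : clear implicits.
Arguments unipotent_upper : clear implicits.
Arguments positive_diagonal : clear implicits.
Arguments symmetric_matrices : clear implicits.

(* Main.v *)
Require Import Defs.
From HB Require Import structures.
From mathcomp Require Import all_boot all_order all_algebra.
From mathcomp Require Import all_classical all_reals all_analysis.
From mathcomp Require Import complex.

Set Implicit Arguments.
Unset Strict Implicit.
Unset Printing Implicit Defensive.

Import Order.TTheory GRing.Theory Num.Theory.
Import numFieldNormedType.Exports.

Local Open Scope classical_set_scope.
Local Open Scope ring_scope.

(** Everything rests on one identity: if [U] is upper triangular with positive
diagonal, [B] is orthogonal and [P = U *m B], then [iwasawa_kappa P = B]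
([kappa_upperM]).  So the image of the positive definite matrices consists of
the orthogonal [B] for which some such [U] makes [U *m B] symmetric positive
definite.

If [P = U *m B] is positive definite, its trailing principal [r]-block is the
product of the trailing [r]-blocks of [U] and [B], because the last [r] rows of
[U] vanish outside the last [r] columns.  The blocks of [P] and [U] have
positive determinant, hence so does that of [B]
([upperM_trailing_minor_gt0]).

Conversely, positive leading minors give a factorization [B *m V = L] with [V]
upper unipotent and [L] lower triangular with positive diagonal
([leading_minors_lu]).  Then [U = V *m L^T] is upper triangular with positive
diagonal, and [U *m B = V *m V^T *m B^T *m B = V *m V^T] is positive definite.

Leading and trailing conditions agree on orthogonal matrices by Jacobi's
identity: a trailing minor equals [\det B] times the complementary leading
minor ([orthogonal_trailing_minor]).

Finally the exponentials of symmetric matrices are exactly the positive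
definite matrices ([mxexp_symmetric_posdef], [posdef_mxexp]).  Real symmetric
matrices are diagonalizable over the reals, the exponential acts on the
eigenvalues, and a function applied to the eigenvalues of a symmetric matrix
gives again a symmetric matrix ([symmetric_spectral_map]); the eigenvectors are
thus never required to be orthonormal. *)

(** * Triangular matrices with positive diagonal *)

Section PositiveTriangular.
Variable R : realFieldType.

Lemma is_trig_mxM n (L M : 'M[R]_n) :
  is_trig_mx L -> is_trig_mx M -> is_trig_mx (L *m M).
Proof.
move=> /is_trig_mxP Lt /is_trig_mxP Mt; apply/is_trig_mxP => i j ij.
rewrite mxE big1 // => k _; have [ik|ki] := ltnP i k; first by rewrite Lt ?mul0r.
by rewrite Mt ?mulr0 // (leq_ltn_trans ki).
Qed.

Lemma trig_mxM_diag n (L M : 'M[R]_n) i :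
  is_trig_mx L -> is_trig_mx M -> (L *m M) i i = L i i * M i i.
Proof.
move=> /is_trig_mxP Lt /is_trig_mxP Mt.
rewrite mxE (bigD1 i) //= big1 ?addr0 // => k.
by rewrite neq_ltn => /orP[ki|ik]; [rewrite Mt ?mulr0|rewrite Lt ?mul0r].
Qed.

(** Upper triangular matrices with positive diagonal are handled through their
transposes, since [is_trig_mx] means lower triangular. *)
Definition pos_trig n (L : 'M[R]_n) := is_trig_mx L /\ forall i, 0 < L i i.

Lemma pos_trigM n (L M : 'M[R]_n) :
  pos_trig L -> pos_trig M -> pos_trig (L *m M).
Proof.
move=> [Lt Lp] [Mt Mp]; split; first exact: is_trig_mxM.
by move=> i; rewrite trig_mxM_diag // mulr_gt0.
Qed.

Lemma pos_trig_det n (L : 'M[R]_n) : pos_trig L -> 0 < \det L.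
Proof. by move=> [Lt Lp]; rewrite det_trig // prodr_gt0. Qed.

Lemma pos_trig_unitmx n (L : 'M[R]_n) : pos_trig L -> L \in unitmx.
Proof. by move=> /pos_trig_det; rewrite unitmxE unitfE => /lt0r_neq0. Qed.

Lemma pos_trig_block m n (L : 'M[R]_m) (C : 'M[R]_(n, m)) (M : 'M[R]_n) :
  pos_trig (block_mx L 0 C M) <-> pos_trig L /\ pos_trig M.
Proof.
rewrite /pos_trig is_trig_block_mx // eqxx /=.
split=> [[/andP[Lt Mt] Dp]|[[Lt Lp] [Mt Mp]]].
  by split; split=> // i; [have := Dp (lshift _ i)|have := Dp (rshift _ i)];
    rewrite ?block_mxEul ?block_mxEdr.
split=> [|i]; first by rewrite Lt.
by case: (split_ordP i) => j ->; rewrite ?block_mxEul ?block_mxEdr.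
Qed.

(** Uniqueness in the Cholesky factorization.  Peeling off the first row and
column, the lower right block of [L] is known by induction; it is invertible,
so it determines the column below the corner, and the corner is then the
positive square root of a known number. *)
Lemma pos_trig_gram_inj n (L M : 'M[R]_n) :
  pos_trig L -> pos_trig M -> L^T *m L = M^T *m M -> L = M.
Proof.
elim: n => [|n IHn] in L M *; first by rewrite !thinmx0.
rewrite -add1n in L M *; rewrite -[L]submxK -[M]submxK.
set l := ulsubmx L; set m := ulsubmx M; set c := dlsubmx L; set d := dlsubmx M.
set L1 := drsubmx L; set M1 := drsubmx M.
have ur0 (N : 'M[R]_(1 + n)) : is_trig_mx N -> ursubmx N = 0.
  by rewrite -{1}[N]submxK is_trig_block_mx // => /and3P[/eqP].
move=> Lp Mp; have [Lt _] := Lp; have [Mt _] := Mp.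
rewrite submxK in Lt; rewrite submxK in Mt.
rewrite (ur0 L) ?(ur0 M) // in Lp Mp *.
have [lp L1p] := (pos_trig_block _ _ _).1 Lp.
have [mp M1p] := (pos_trig_block _ _ _).1 Mp.
rewrite !tr_block_mx !trmx0 !mulmx_block !mul0mx !mulmx0 !add0r.
move=> /eq_block_mx[eq_ul _ eq_dl eq_dr].
have eqLM : L1 = M1 by exact: IHn.
have eqcd : c = d.
  move: eq_dl; rewrite eqLM => /(congr1 (mulmx (invmx M1^T))).
  by rewrite !mulKmx // unitmx_tr pos_trig_unitmx.
rewrite eqLM eqcd; congr block_mx.
move: eq_ul; rewrite eqcd => /addIr /matrixP/(_ 0 0).
have sqE (x : 'M[R]_1) : (x^T *m x) 0 0 = x 0 0 ^+ 2.
  by rewrite mxE big_ord1 mxE.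
rewrite !sqE => /eqP.
have [_ /(_ 0) lp0] := lp; have [_ /(_ 0) mp0] := mp.
rewrite eqrXn2 ?ltW // => /eqP lm.
by apply/matrixP => i j; rewrite !ord1.
Qed.

End PositiveTriangular.

(** * Minors of orthogonal matrices and triangular factorizations *)

Section Minors.
Variable R : realType.

(** Jacobi's identity on complementary minors, for which the inverse is the
transpose.  With [K = block_mx A B C D], the relation [K *m K^T = 1] says that
multiplying [K] by the transpose of its first block row, completed by a unit
block, gives a block upper triangular matrix; compare determinants. *)
Lemma orthogonal_complementary_minors p q (K : 'M[R]_(p + q)) :
  orthogonal_group R _ K -> \det (drsubmx K) = \det K * \det (ulsubmx K).
Proof.
rewrite /orthogonal_group /= => KK.
set A := ulsubmx K; set B := ursubmx K.
have KE : K *m block_mx A^T 0 B^T 1%:M = block_mx 1%:M B 0 (drsubmx K).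
  move: KK; rewrite -{1 2 3}[K]submxK tr_block_mx !mulmx_block.
  rewrite (scalar_mx_block p q) => /eq_block_mx[-> _ -> _].
  by rewrite !mulmx0 !add0r !mulmx1.
have := congr1 determinant KE.
by rewrite det_mulmx det_lblock det_ublock !det1 mulr1 mul1r det_tr.
Qed.

Lemma orthogonal_trailing_minor n (B : 'M[R]_n) r s
    (hr : (r <= n)%N) (hs : (s <= n)%N) :
  orthogonal_group R n B -> (r + s)%N = n ->
  trailing_minor hs B = \det B * leading_minor hr B.
Proof.
rewrite /trailing_minor /leading_minor => + nE; subst n => BO.
have -> : widen_ord hr = @lshift r s by apply/funext => i; apply/val_inj.
have -> : trailing_ord hs = @rshift r s.
  by apply/funext => i; apply/val_inj; rewrite /= addnK.
rewrite -ulsubmxEsub -drsubmxEsub; exact: orthogonal_complementary_minors.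
Qed.

Lemma leading_minor_full n (B : 'M[R]_n) (h : (n <= n)%N) :
  leading_minor h B = \det B.
Proof.
by rewrite -[in RHS](mxsub_id B); congr (\det (mxsub _ _ _));
  apply/funext => i; apply/val_inj.
Qed.

Lemma leading_minor0 n (B : 'M[R]_n) (h : (0 <= n)%N) : leading_minor h B = 1.
Proof. exact: det_mx00. Qed.

Lemma trailing_minor_full n (B : 'M[R]_n) (h : (n <= n)%N) :
  trailing_minor h B = \det B.
Proof.
rewrite -[in RHS](mxsub_id B); congr (\det (mxsub _ _ _));
  by apply/funext => i; apply/val_inj; rewrite /= subnn.
Qed.

Lemma trailing_minor0 n (B : 'M[R]_n) (h : (0 <= n)%N) : trailing_minor h B = 1.
Proof. exact: det_mx00. Qed.

Lemma orthogonal_minors_gt0 n (B : 'M[R]_n) : (1 <= n)%N ->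
  orthogonal_group R n B ->
  (forall r (hr : (r <= n)%N), (1 <= r)%N -> 0 < leading_minor hr B) <->
  (forall r (hr : (r <= n)%N), (1 <= r)%N -> 0 < trailing_minor hr B).
Proof.
move=> n1 BO; split=> Bp r hr _.
- have detB : 0 < \det B by rewrite -(leading_minor_full _ (leqnn n)) Bp.
  rewrite (orthogonal_trailing_minor (leq_subr r n) _ BO) ?subnK //.
  rewrite mulr_gt0 //; move: (leq_subr r n); case: (n - r)%N => [|q] hq.
    by rewrite leading_minor0.
  exact: Bp.
- have detB : 0 < \det B by rewrite -(trailing_minor_full _ (leqnn n)) Bp.
  rewrite -(pmulr_rgt0 _ detB).
  rewrite -(orthogonal_trailing_minor hr (leq_subr r n) BO) ?subnKC //.
  move: (leq_subr r n); case: (n - r)%N => [|q] hq.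
    by rewrite trailing_minor0.
  exact: Bp.
Qed.

Lemma leading_minor_ulsubmx n (B : 'M[R]_(n + 1)) r (hr : (r <= n)%N)
    (hr1 : (r <= n + 1)%N) :
  leading_minor hr (ulsubmx B) = leading_minor hr1 B.
Proof.
rewrite /leading_minor ulsubmxEsub -mxsub_comp.
by congr (\det (mxsub _ _ _)); apply/funext => i; apply/val_inj.
Qed.

(** Column elimination without pivoting.  In the inductive step the last column
of [B] is cleared above its last entry using the invertible block [A]; since
[V] has determinant 1, the entry left in the corner is the quotient of the last
two leading minors, hence positive. *)
Lemma leading_minors_lu n (B : 'M[R]_n) :
  (forall r (hr : (r <= n)%N), 0 < leading_minor hr B) ->
  exists V : 'M[R]_n,
    [/\ is_trig_mx V^T, forall i, V i i = 1 & pos_trig (B *m V)].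
Proof.
elim: n => [|n IHn] in B *.
  move=> _; exists 1%:M; split=> [|[]//|]; first by rewrite trmx1 scalar_mx_is_trig.
  by split=> [|[]//]; apply/is_trig_mxP => - [].
rewrite -addn1 in B * => Bp.
set A := ulsubmx B; set b := ursubmx B; set c := dlsubmx B; set d := drsubmx B.
have Ap r (hr : (r <= n)%N) : 0 < leading_minor hr A.
  by rewrite (leading_minor_ulsubmx _ _ (leq_trans hr (leq_addr 1 n))).
have Au : A \in unitmx.
  by rewrite unitmxE unitfE -(leading_minor_full _ (leqnn n)) lt0r_neq0.
have [V0 [V0t V01 AV0]] := IHn _ Ap.
pose V := block_mx V0 (- invmx A *m b) 0 1%:M.
have Vt : is_trig_mx V^T.
  by rewrite tr_block_mx trmx0 trmx1 is_trig_block_mx // eqxx V0t scalar_mx_is_trig.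
have V1 i : V i i = 1.
  by case: (split_ordP i) => j ->; rewrite ?block_mxEul ?block_mxEdr // mxE eqxx.
exists V; split=> //.
have BV : B *m V = block_mx (A *m V0) 0 (c *m V0) (d - c *m invmx A *m b).
  rewrite -{1}[B]submxK mulmx_block !mulmx0 !mulmx1 !addr0 mulNmx !mulmxN.
  by rewrite !mulmxA mulmxV // mul1mx addNr addrC.
have detV : \det V = 1.
  by rewrite -det_tr det_trig // big1 // => i _; rewrite mxE V1.
rewrite BV; apply/pos_trig_block; split=> //.
set s := d - _ in BV *; split=> [|i]; first exact: mx11_is_trig.
have detB : 0 < \det B by rewrite -(leading_minor_full _ (leqnn _)).
move: detB; rewrite -[\det B]mulr1 -detV -det_mulmx BV det_lblock det_mx11.
by rewrite pmulr_rgt0 ?pos_trig_det // ord1.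
Qed.

Lemma pos_trig_NA n (u a : 'M[R]_n) :
  unipotent_upper R n u -> positive_diagonal R n a -> pos_trig (u *m a)^T.
Proof.
move=> [ut u1] [ad ap].
have aTt : is_trig_mx a^T by rewrite is_diag_mx_is_trig // is_diag_trmx.
by rewrite trmx_mul; apply: pos_trigM; split=> // i; rewrite mxE ?u1.
Qed.

(** Two Iwasawa decompositions of the same matrix have triangular parts with the
same Gram matrix, because the orthogonal factors cancel; by uniqueness of the
Cholesky factorization these triangular parts coincide. *)
Lemma kappa_upperM n (U K : 'M[R]_n) :
  pos_trig U^T -> orthogonal_group R n K -> iwasawa_kappa (U *m K) = K.
Proof.
move=> Up KO; rewrite /iwasawa_kappa; case: xgetP => [k _|noK] /=; last first.
  exfalso; apply: (noK K); split=> //.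
  pose a := diag_mx (\row_i U i i); pose a' := diag_mx (\row_i (U i i)^-1).
  have [Ut Ud] := Up.
  have U0 i : 0 < U i i by have := Ud i; rewrite mxE.
  exists (U *m a'), a; split.
  - split=> [|i]; last by rewrite mul_mx_diag !mxE divff ?lt0r_neq0.
    by rewrite trmx_mul tr_diag_mx is_trig_mxM // diag_mx_is_trig.
  - split=> [|i]; first exact: diag_mx_is_diag.
    by rewrite !mxE eqxx mulr1n.
  - congr (_ *m _); rewrite !mul_mx_diag; apply/matrixP => i j.
    by rewrite !mxE mulfVK ?lt0r_neq0.
move=> [kO [u [a [uN aA UK]]]]; have uap := pos_trig_NA uN aA.
have Uua : U = u *m a.
  apply: trmx_inj; apply: pos_trig_gram_inj => //; rewrite !trmxK.
  have gramE (X k' : 'M[R]_n) : k' *m k'^T = 1%:M ->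
      (X *m k') *m (X *m k')^T = X *m X^T.
    by move=> k'O; rewrite trmx_mul mulmxA -(mulmxA X) k'O mulmx1.
  by rewrite -(gramE U K) // UK gramE.
move: UK; rewrite -Uua => /(congr1 (mulmx (invmx U))).
by rewrite !mulKmx // -unitmx_tr pos_trig_unitmx.
Qed.

End Minors.

(** * Diagonalization of real symmetric matrices *)

Section Spectral.
Variable R : rcfType.

(** Over the complex numbers [S] is hermitian, hence similar to a real diagonal
matrix; two real matrices that are similar over the complex numbers are similar
through a real matrix. *)
Lemma symmetric_diagonalizable n (S : 'M[R]_n) : S^T = S ->
  exists V d, V \in unitmx /\ S = invmx V *m diag_mx d *m V.
Proof.
move=> Ssym; pose toC := real_complex R.
pose SC := map_mx toC S.
have SCreal : SC \is a mxOver Num.real.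
  apply/mxOverP => i j; rewrite mxE; by apply/complex_realP; exists (S i j).
have SCsym : SC \is symmetricmx.
  apply/is_hermitianmxP; rewrite expr0 scale1r map_mx_id //.
  by rewrite /SC map_trmx Ssym.
have SCherm := realsym_hermsym SCsym SCreal.
have /orthomx_spectralP SCE := hermitian_normalmx SCherm.
have dreal := hermitian_spectral_diag_real SCherm.
have Dreal : diag_mx (spectral_diag SC) \is a mxOver Num.real.
  apply/mxOverP => i j; rewrite mxE rpredMn //; exact: (mxOverP dreal).
have sim : SC ~_{in unitmx} (diag_mx (spectral_diag SC)).
  exists (spectralmx SC); first exact: spectral_unit.
  apply/simmxP; first exact: spectral_unit.
  by rewrite {2}SCE !mulmxA mulmxV ?mul1mx // spectral_unit.
have [Q + QSC] := real_similar sim SCreal Dreal.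
rewrite inE => /andP[Qreal Qu].
have realE m k (M : 'M[R[i]]_(m, k)) : M \is a mxOver Num.real ->
    M = map_mx toC (map_mx (@complex.Re R) M).
  move=> /mxOverP Mreal; apply/matrixP => i j.
  by rewrite !mxE /toC RRe_real.
move: QSC => /(simmxP Qu).
rewrite (realE _ _ Q Qreal) (realE _ _ _ dreal).
set V := map_mx _ Q; set d := map_mx _ (spectral_diag _).
rewrite -map_diag_mx -!map_mxM => /map_mx_inj VS.
have Vu : V \in unitmx by rewrite -(map_unitmx toC) -realE.
exists V, d; split=> //.
by rewrite -mulmxA -VS mulKmx.
Qed.

(** For symmetric [V^-1 D V], symmetry says that the Gram matrix [V *m V^T]
commutes with [D], that is, its entry (i, j) vanishes unless the eigenvalues
[d 0 i] and [d 0 j] are equal.  That condition persists when [f] is applied to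
the eigenvalues. *)
Lemma symmetric_spectral_map n (V : 'M[R]_n) (d : 'rV[R]_n) (f : R -> R) :
  V \in unitmx ->
  (invmx V *m diag_mx d *m V)^T = invmx V *m diag_mx d *m V ->
  (invmx V *m diag_mx (map_mx f d) *m V)^T
    = invmx V *m diag_mx (map_mx f d) *m V.
Proof.
move=> Vu; pose G := V *m V^T.
have symE (e : 'rV[R]_n) :
    (invmx V *m diag_mx e *m V)^T = invmx V *m diag_mx e *m V <->
    G *m diag_mx e = diag_mx e *m G.
  rewrite !trmx_mul tr_diag_mx trmx_inv; split=> [eqe|Ge].
    have := congr1 (fun X => V *m X *m V^T) eqe.
    by rewrite !mulmxA mulmxKV ?unitmx_tr // mulmxV // mul1mx -(mulmxA (diag_mx e)).
  apply: (can_inj (mulKmx Vu)); apply: (can_inj (mulmxK (_ : V^T \in unitmx))).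
    by rewrite unitmx_tr.
  by rewrite !mulmxA mulmxKV ?unitmx_tr // mulmxV // mul1mx -(mulmxA (diag_mx e)).
move=> /symE Gd; apply/symE; move: (G) Gd => M /matrixP Md.
apply/matrixP => i j; have := Md i j.
rewrite !mul_mx_diag !mul_diag_mx !mxE => Mdij.
have [Mij0|Mij0] := eqVneq (M i j) 0; first by rewrite Mij0 mul0r mulr0.
rewrite mulrC; congr (f _ * _); apply: (mulfI Mij0).
by rewrite Mdij mulrC.
Qed.

End Spectral.

(** * Positive definite matrices *)

Section PositiveDefinite.
Variable R : rcfType.

Definition posdef n (P : 'M[R]_n) :=
  P^T = P /\ forall v : 'rV_n, v != 0 -> 0 < (v *m P *m v^T) 0 0.

Lemma dot_gt0 n (v : 'rV[R]_n) : v != 0 -> 0 < (v *m v^T) 0 0.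
Proof.
move=> v0; have [i vi] : exists i, v 0 i != 0.
  by apply/existsP; apply: contra_neqT v0 => /existsPn v0; apply/rowP => i;
    rewrite mxE; apply/eqP; have := v0 i; rewrite negbK.
rewrite mxE (bigD1 i) //= ltr_pwDl //.
  by rewrite mxE -expr2 exprn_even_gt0.
by apply: sumr_ge0 => j _; rewrite mxE -expr2 sqr_ge0.
Qed.

Lemma posdef_gram n (E : 'M[R]_n) : E \in unitmx -> posdef (E *m E^T).
Proof.
move=> Eu; split=> [|v v0]; first by rewrite trmx_mul trmxK.
rewrite mulmxA -mulmxA -trmx_mul dot_gt0 //.
by apply: contra_neq v0 => /(congr1 (mulmx^~ (invmx E))); rewrite mulmxK // mul0mx.
Qed.

(** A principal submatrix is [F *m P *m F^T] where [F] selects the rows, and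
[v *m F] pads [v] with zeros; [F *m F^T = 1] keeps it nonzero. *)
Lemma posdef_mxsub m n (f : 'I_m -> 'I_n) (P : 'M[R]_n) :
  injective f -> posdef P -> posdef (mxsub f f P).
Proof.
move=> finj [Psym Ppos]; split=> [|v v0].
  by apply/matrixP => i j; rewrite !mxE -{1}Psym mxE.
pose F : 'M[R]_(m, n) := rowsub f 1%:M.
have PE : mxsub f f P = F *m P *m F^T.
  rewrite /F trmx_mxsub trmx1 mulmx_colsub mulmx1 mul_rowsub_mx mul1mx.
  by rewrite -mxsub_comp.
have FF : F *m F^T = 1%:M.
  rewrite /F trmx_mxsub trmx1 mulmx_colsub mulmx1 -mxsub_comp.
  by apply/matrixP => i j; rewrite !mxE (inj_eq finj).
rewrite PE !mulmxA -mulmxA -trmx_mul Ppos //.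
by apply: contra_neq v0 => /(congr1 (mulmx^~ F^T)); rewrite -mulmxA FF mulmx1 mul0mx.
Qed.

(** The rows of [V] are left eigenvectors; evaluate the quadratic form there. *)
Lemma posdef_eigenvalue_gt0 n (V : 'M[R]_n) (d : 'rV[R]_n) : V \in unitmx ->
  posdef (invmx V *m diag_mx d *m V) -> forall i, 0 < d 0 i.
Proof.
move=> Vu [_ Ppos] i.
have v0 : row i V != 0.
  apply/eqP => /(congr1 (mulmx^~ (invmx V))); rewrite -row_mul mulmxV // mul0mx.
  by move=> /rowP/(_ i)/eqP; rewrite !mxE eqxx oner_eq0.
have := Ppos _ v0.
rewrite !mulmxA -row_mul mulmxV // -row_mul mul1mx row_diag_mx.
rewrite -scalemxAl -rowE -scalemxAl mxE pmulr_lgt0 //; exact: dot_gt0.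
Qed.

Lemma posdef_det_gt0 n (P : 'M[R]_n) : posdef P -> 0 < \det P.
Proof.
move=> Ppd; have [V [d [Vu PE]]] := symmetric_diagonalizable Ppd.1.
rewrite PE in Ppd *; rewrite det_mulmx mulrC det_mulmx mulrA -det_mulmx.
rewrite mulmxV // det1 mul1r det_diag prodr_gt0 // => i _.
exact: posdef_eigenvalue_gt0 Ppd i.
Qed.

End PositiveDefinite.

(** * The exponential of symmetric matrices *)

Section Exponential.
Variable R : realType.

Lemma cvg_mx_entries (T : ptopologicalType) m n (U : Type) (F : set_system U)
    (FF : Filter F) (f : U -> 'M[T]_(m, n)) (M : 'M[T]_(m, n)) :
  (forall i j, f x i j @[x --> F] --> M i j) -> f x @[x --> F] --> M.
Proof.
move=> fM A [P PM PA]; rewrite /= nbhs_simpl.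
apply: (filterS (P := fun x => forall i j, P i j (f x i j))) => [x Px|].
  exact: PA.
by apply: filter_forall => i; apply: filter_forall => j; apply: fM; apply: PM.
Qed.

Lemma mxexp_diag n (V : 'M[R]_n) (d : 'rV[R]_n) : V \in unitmx ->
  mxexp (invmx V *m diag_mx d *m V)
    = invmx V *m diag_mx (map_mx expR d) *m V.
Proof.
move=> Vu; rewrite /mxexp; apply: cvg_lim; first exact: norm_hausdorff.
set X := _ *m _ *m V.
have XE k : X ^+ k = invmx V *m diag_mx (map_mx (fun x => x ^+ k) d) *m V.
  elim: k => [|k IHk].
    rewrite expr0 (_ : diag_mx _ = 1%:M) ?mulmx1 ?mulVmx //.
    by rewrite -diag_const_mx; congr diag_mx; apply/rowP => i; rewrite !mxE.
  rewrite exprSr IHk -mulmxE /X !mulmxA mulmxK // -!(mulmxA (invmx V)).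
  congr (_ *m (_ *m V)); rewrite mul_diag_mx; apply/matrixP => i j.
  by rewrite !mxE exprSr mulrnAr.
pose s N := map_mx (fun x => series (exp_coeff x) N) d.
have -> : series (fun k => (k`!%:R)^-1 *: X ^+ k)
    = (fun N => invmx V *m diag_mx (s N) *m V).
  apply/funext => N; rewrite /series /=.
  elim: N => [|N IHN].
    rewrite big_geq // (_ : s 0%N = 0) ?linear0 ?mulmx0 ?mul0mx //.
    by apply/rowP => i; rewrite !mxE /series /= big_geq.
  rewrite big_nat_recr //= IHN XE scalemxAl scalemxAr -mulmxDl -mulmxDr.
  rewrite -linearZ -linearD /=; congr (_ *m diag_mx _ *m _).
  by apply/rowP => i; rewrite !mxE /series /= big_nat_recr //= exp_coeffE.
apply: cvg_mx_entries => i j.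
have entryE (w : 'rV[R]_n) : (invmx V *m diag_mx w *m V) i j
    = \sum_(k < n) invmx V i k * w 0 k * V k j.
  by rewrite mul_mx_diag mxE; apply: eq_bigr => k _; rewrite mxE.
rewrite entryE; under eq_fun do rewrite entryE.
apply: cvg_big; first exact: add_continuous.
move=> k _; apply: cvgMr_tmp; apply: cvgMl_tmp; rewrite mxE.
under eq_fun do rewrite mxE.
exact: is_cvg_series_exp_coeff.
Qed.

(** The square root of the exponential, obtained by halving the eigenvalues, is
symmetric and invertible. *)
Lemma mxexp_symmetric_posdef n (S : 'M[R]_n) : S^T = S -> posdef (mxexp S).
Proof.
move=> Ssym; have [V [d [Vu SE]]] := symmetric_diagonalizable Ssym.
rewrite SE mxexp_diag //.
pose h := map_mx (fun x => expR (x / 2)) d.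
pose E := invmx V *m diag_mx h *m V.
have ET : E^T = E by apply: symmetric_spectral_map => //; rewrite -SE.
have EE : invmx V *m diag_mx (map_mx expR d) *m V = E *m E^T.
  rewrite ET /E !mulmxA mulmxK // -!(mulmxA (invmx V)); congr (_ *m (_ *m V)).
  rewrite mul_diag_mx; apply/matrixP => i j.
  by rewrite !mxE mulrnAr -expRD -splitr.
rewrite EE; apply: posdef_gram.
rewrite !unitmx_mul unitmx_inv Vu andbT /= unitmxE det_diag unitfE.
by apply/prodf_neq0 => i _; rewrite mxE expR_eq0.
Qed.

Lemma posdef_mxexp n (P : 'M[R]_n) : posdef P ->
  exists2 S, S^T = S & mxexp S = P.
Proof.
move=> Ppd; have [V [d [Vu PE]]] := symmetric_diagonalizable Ppd.1.
rewrite PE in Ppd *; have dp := posdef_eigenvalue_gt0 Vu Ppd.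
exists (invmx V *m diag_mx (map_mx (@ln R) d) *m V).
  by apply: symmetric_spectral_map; last exact: Ppd.1.
rewrite mxexp_diag //; congr (_ *m diag_mx _ *m _).
by apply/rowP => i; rewrite !mxE lnK // posrE.
Qed.

End Exponential.

(** * The image of the positive definite matrices *)

Lemma upperM_trailing_minor_gt0 (R : realType) n (U K : 'M[R]_n) r
    (hr : (r <= n)%N) :
  pos_trig U^T -> posdef (U *m K) -> 0 < trailing_minor hr K.
Proof.
move: (subnK hr); move: (n - r)%N => p nE; subst n => Up UKpd.
have := posdef_det_gt0 (posdef_mxsub (@rshift_inj p r) UKpd).
have [dl0 drUp] : dlsubmx U = 0 /\ pos_trig (drsubmx U)^T.
  move: Up; rewrite -{1}[U]submxK tr_block_mx => Up.
  have [+ _] := Up; rewrite is_trig_block_mx // => /and3P[/eqP dlT0 _ _].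
  move: Up; rewrite dlT0 => /pos_trig_block[_ drUp]; split=> //.
  by apply: trmx_inj; rewrite dlT0 trmx0.
have -> : mxsub (@rshift p r) (@rshift p r) (U *m K)
    = drsubmx U *m drsubmx K.
  rewrite -drsubmxEsub -{1}[U]submxK -{1}[K]submxK mulmx_block block_mxKdr.
  by rewrite dl0 mul0mx add0r.
rewrite det_mulmx pmulr_rgt0; last by rewrite -det_tr pos_trig_det.
rewrite /trailing_minor drsubmxEsub; congr (0 < \det (mxsub _ _ _));
  by apply/funext => i; apply/val_inj; rewrite /= addnK.
Qed.

Theorem proposition3p1 (R : realType) (n : nat) (n_ge1 : (1 <= n)%N) :
  @iwasawa_kappa R n @` (@mxexp R n @` symmetric_matrices R n)
    = [set B | orthogonal_group R n B /\
        forall (r : nat) (hr : (r <= n)%N), (1 <= r)%N -> 0 < leading_minor hr B]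
  /\
  [set B | orthogonal_group R n B /\
        forall (r : nat) (hr : (r <= n)%N), (1 <= r)%N -> 0 < leading_minor hr B]
    = [set B | orthogonal_group R n B /\
        forall (r : nat) (hr : (r <= n)%N), (1 <= r)%N -> 0 < trailing_minor hr B].
Proof.
split; last first.
  by apply/seteqP; split=> B /= [BO Bp]; split=> //;
    apply/(orthogonal_minors_gt0 n_ge1 BO).
apply/seteqP; split=> [_ [_ [S Ssym <-] <-]|B [BO Bp]] /=.
- have Ppd := mxexp_symmetric_posdef Ssym.
  rewrite /iwasawa_kappa; case: xgetP => [k _ [kO [u [a [uN aA PE]]]]|_].
    split=> //; apply/(orthogonal_minors_gt0 n_ge1 kO) => r hr _.
    apply: (upperM_trailing_minor_gt0 (U := u *m a)); last by rewrite -PE.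
    exact: pos_trig_NA.
  (* Here [iwasawa_kappa] takes its default value 1, whose minors are all 1. *)
  split=> [|r hr _]; first by rewrite /orthogonal_group /= trmx1 mulmx1.
  rewrite /leading_minor (_ : mxsub _ _ _ = 1%:M) ?det1 //.
  by apply/matrixP => i j; rewrite !mxE -val_eqE.
- have [V [Vt V1 BVp]] : exists V : 'M[R]_n,
      [/\ is_trig_mx V^T, forall i, V i i = 1 & pos_trig (B *m V)].
    apply: leading_minors_lu => -[|r] hr; last exact: Bp.
    by rewrite leading_minor0.
  have VTp : pos_trig V^T by split=> // i; rewrite mxE V1.
  have Vpd : posdef (V *m V^T).
    by apply: posdef_gram; rewrite -unitmx_tr pos_trig_unitmx.
  have [S Ssym SE] := posdef_mxexp Vpd.
  exists (V *m V^T); first by exists S.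
  have -> : V *m V^T = V *m (B *m V)^T *m B.
    by rewrite trmx_mul !mulmxA -(mulmxA (V *m V^T)) (mulmx1C BO) mulmx1.
  by apply: kappa_upperM => //; rewrite trmx_mul trmxK; exact: pos_trigM.
Qed.
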